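(* Let $R$ be a commutative ring, $P_0$ a projective $R$-module of constant rank $2$ with a trivialization $\theta_0:R\xrightarrow{\cong}\det(P_0)$, and let $\chi_0:P_0\to P_0^\vee$ be the alternating isomorphism $\chi_0(q)=(p\mapsto\theta_0^{-1}(p\wedge q))$. Let $a=(a_0,a_R): P_0\oplus R\to R$ be a surjective $R$-linear map with a section $s:R\to P_0\oplus R$ of $a$, and write $s(1)=(q,p)\in P_0\oplus R$. Define $$\varphi_0=-(\pi_{P_0}s)\circ\chi_0(q)-p\cdot id_{P_0}:P_0\to P_0,\qquad \varphi_R:R\to P_0,\ 1\mapsto 2a_R(1)\cdot q+\chi_0^{-1}(a_0),$$ and let $\varphi$ be the endomorphism of $P_0\oplus R$ given by $$\varphi=\begin{pmatrix}\varphi_0&\varphi_R\\ a_0&a_R^2\end{pmatrix}.$$ Then $\varphi$ is an automorphism of $P_0\oplus R$ of determinant $1$ such that $\pi_R\varphi=(a_0,a_R^2)$.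
   Context: For $a:P_0\oplus R\to R$, $a_0$ and $a_R$ denote the restrictions of $a$ to $P_0$ and $R$; $a_R^2:R\to R$ is multiplication by $a_R(1)^2$. $\pi_{P_0}$ and $\pi_R$ are the projections of $P_0\oplus R$ onto $P_0$ and $R$. $\chi_0(q)\in P_0^\vee$ is a linear map $P_0\to R$, so $(\pi_{P_0}s)\circ\chi_0(q)$ is an endomorphism of $P_0$, namely $x\mapsto\chi_0(q)(x)\cdot q$. *)

(* Defs.v *)
From HB Require Import structures.
From mathcomp Require Import all_boot all_algebra ring.
From mathcomp Require Import boolp classical_sets.

Set Implicit Arguments.
Unset Strict Implicit.
Unset Printing Implicit Defensive.

Import GRing.Theory.
Local Open Scope ring_scope.
Local Open Scope quotient_scope.

(* Rings are comPzRingType, so that the zero ring is allowed; the prime ideals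
   of ring_quotient require a nzRingType. *)
Record prime_ideal (R : comPzRingType) := PrimeIdeal {
  prime_pred :> {pred R};
  prime0 : 0 \in prime_pred;
  primeD : {in prime_pred &, forall x y, x + y \in prime_pred};
  primeMl : forall a, {in prime_pred, forall x, a * x \in prime_pred};
  prime1 : 1 \notin prime_pred;
  primeM : forall x y, x * y \in prime_pred ->
             (x \in prime_pred) || (y \in prime_pred)
}.

(* The localization M_p: fractions m/s with s outside p, where m/s = m'/s' iff
   u (s' m - s m') = 0 for some u outside p. *)
Section Localization.
Variables (R : comPzRingType) (p : prime_ideal R).

Definition denom := {s : R | s \notin p}.

Definition denom1 : denom := Sub 1 (prime1 p).

Fact denomM_subproof (s t : denom) : sval s * sval t \notin p.
Proof.
by apply/negP => /primeM; rewrite (negPf (valP s)) (negPf (valP t)).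
Qed.
Definition denomM (s t : denom) : denom :=
  Sub (sval s * sval t) (denomM_subproof s t : _ \notin p).

Section Module.
Variable M : lmodType R.

Definition loc_eqv : rel (M * denom) := fun x y =>
  `[< exists u : denom,
        sval u *: (sval y.2 *: x.1) = sval u *: (sval x.2 *: y.1) >].

Fact loc_eqv_refl : reflexive loc_eqv.
Proof. by move=> x; apply/asboolP; exists denom1. Qed.

Fact loc_eqv_sym : symmetric loc_eqv.
Proof. by move=> x y; apply/asboolP/asboolP => -[u e]; exists u. Qed.

Fact loc_eqv_trans : transitive loc_eqv.
Proof.
move=> y x z /asboolP[u e] /asboolP[v f]; apply/asboolP.
exists (denomM (denomM u v) y.2); rewrite /= !scalerA in e f *.
transitivity ((sval v * sval z.2) *: ((sval u * sval y.2) *: x.1)).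
  by rewrite scalerA; congr (_ *: _); ring.
rewrite e scalerA.
transitivity ((sval u * sval x.2) *: ((sval v * sval z.2) *: y.1)).
  by rewrite scalerA; congr (_ *: _); ring.
by rewrite f scalerA; congr (_ *: _); ring.
Qed.

Canonical loc_equiv :=
  EquivRel loc_eqv loc_eqv_refl loc_eqv_sym loc_eqv_trans.

Definition loc : Type := {eq_quot loc_equiv}.
HB.instance Definition _ := EqQuotient.on loc.
HB.instance Definition _ := Choice.on loc.

Definition frac (m : M) (s : denom) : loc := \pi_loc (m, s).

Lemma fracP (m m' : M) (s s' : denom) :
  frac m s = frac m' s' <->
  exists u : denom, sval u *: (sval s' *: m) = sval u *: (sval s *: m').
Proof.
split=> [/eqmodP/asboolP //|h].
by apply/eqmodP/asboolP.
Qed.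

Lemma fracE (x : loc) : x = frac (repr x).1 (repr x).2.
Proof. by rewrite /frac -surjective_pairing reprK. Qed.

Lemma fracW (P : loc -> Prop) : (forall m s, P (frac m s)) -> forall x, P x.
Proof. by move=> h x; rewrite (fracE x). Qed.

Definition loc_zero : loc := frac 0 denom1.

Definition loc_add (x y : loc) : loc :=
  let: ((m, s), (m', s')) := (repr x, repr y) in
  frac (sval s' *: m + sval s *: m') (denomM s s').

Definition loc_opp (x : loc) : loc := frac (- (repr x).1) (repr x).2.

Lemma repr_frac m s : exists u : denom,
  sval u * sval s *: (repr (frac m s)).1 = sval u * sval (repr (frac m s)).2 *: m.
Proof.
have [+ _] := fracP (repr (frac m s)).1 m (repr (frac m s)).2 s.
by rewrite -fracE => /(_ erefl)[u]; rewrite !scalerA => e; exists u.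
Qed.

Lemma loc_addE m s m' s' : loc_add (frac m s) (frac m' s') =
  frac (sval s' *: m + sval s *: m') (denomM s s').
Proof.
rewrite /loc_add.
have [u] := repr_frac m s; have [v] := repr_frac m' s'.
case: (repr (frac m s)) => n t; case: (repr (frac m' s')) => n' t' /= e' e.
apply/fracP; exists (denomM u v); rewrite /= !scalerDr !scalerA; congr (_ + _).
  transitivity ((sval v * sval s' * sval t') *: ((sval u * sval s) *: n)).
    by rewrite scalerA; congr (_ *: _); ring.
  by rewrite e scalerA; congr (_ *: _); ring.
transitivity ((sval u * sval s * sval t) *: ((sval v * sval s') *: n')).
  by rewrite scalerA; congr (_ *: _); ring.
by rewrite e' scalerA; congr (_ *: _); ring.
Qed.

Lemma loc_oppE m s : loc_opp (frac m s) = frac (- m) s.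
Proof.
rewrite /loc_opp; have [u] := repr_frac m s.
case: (repr (frac m s)) => n t /= e.
by apply/fracP; exists u; rewrite !scalerN !scalerA e.
Qed.

Lemma frac_eq (m m' : M) (s s' : denom) :
  sval s' *: m = sval s *: m' -> frac m s = frac m' s'.
Proof. by move=> e; apply/fracP; exists denom1; rewrite e. Qed.

Fact loc_addA : associative loc_add.
Proof.
elim/fracW=> m s; elim/fracW=> n t; elim/fracW=> k u.
rewrite !loc_addE; apply: frac_eq; rewrite /= !scalerDr !scalerA addrA.
by congr (_ *: _ + _ *: _ + _ *: _); ring.
Qed.

Fact loc_addC : commutative loc_add.
Proof.
elim/fracW=> m s; elim/fracW=> n t.
rewrite !loc_addE; apply: frac_eq; rewrite /= !scalerDr !scalerA addrC.
by congr (_ *: _ + _ *: _); ring.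
Qed.

Fact loc_add0 : left_id loc_zero loc_add.
Proof.
elim/fracW=> m s; rewrite loc_addE; apply: frac_eq.
by rewrite /= scaler0 add0r scale1r mul1r.
Qed.

Fact loc_addN : left_inverse loc_zero loc_opp loc_add.
Proof.
elim/fracW=> m s; rewrite loc_oppE loc_addE; apply: frac_eq.
by rewrite /= scalerN addNr !scaler0.
Qed.

HB.instance Definition _ :=
  GRing.isZmodule.Build loc loc_addA loc_addC loc_add0 loc_addN.

Lemma fracD m s m' s' :
  frac m s + frac m' s' = frac (sval s' *: m + sval s *: m') (denomM s s').
Proof. exact: loc_addE. Qed.
End Module.

Let regE (a : R) (b : R^o) : a *: b = a * b :> R. Proof. by []. Qed.

Definition loc_scale (M : lmodType R) (a : loc R^o) (x : loc M) : loc M :=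
  frac ((repr a).1 *: (repr x).1) (denomM (repr a).2 (repr x).2).

Lemma loc_scaleE (M : lmodType R) (r : R^o) s (m : M) t :
  loc_scale (frac r s) (frac m t) = frac (r *: m) (denomM s t).
Proof.
rewrite /loc_scale; have [u] := repr_frac r s; have [v] := repr_frac m t.
case: (repr (frac r s)) => r' s'; case: (repr (frac m t)) => m' t' /= e' e.
apply/fracP; exists (denomM u v); rewrite /= !scalerA.
rewrite !regE in e.
transitivity ((sval u * sval s * r') *: ((sval v * sval t) *: m')).
  by rewrite scalerA; congr (_ *: _); ring.
by rewrite e e' scalerA; congr (_ *: _); ring.
Qed.

Definition loc_one : loc R^o := frac (1 : R^o) denom1.

Fact loc_scaleA (M : lmodType R) (a b : loc R^o) (x : loc M) :
  loc_scale a (loc_scale b x) = loc_scale (loc_scale a b) x.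
Proof.
move: a b x; elim/fracW=> r s; elim/fracW=> r' s'; elim/fracW=> m t.
rewrite (loc_scaleE r' s' m t) (loc_scaleE r s r' s') !loc_scaleE.
apply: frac_eq; rewrite /= !regE !scalerA.
by congr (_ *: _); ring.
Qed.

Fact loc_scale1 (M : lmodType R) : left_id loc_one (@loc_scale M).
Proof.
elim/fracW=> m t; rewrite loc_scaleE; apply: frac_eq.
by rewrite /= !scale1r mul1r.
Qed.

Fact loc_scaleDr (M : lmodType R) : right_distributive (@loc_scale M) +%R.
Proof.
elim/fracW=> r s; elim/fracW=> m t; elim/fracW=> m' t'.
rewrite fracD !loc_scaleE fracD; apply: frac_eq; rewrite /= !scalerDr !scalerA.
by congr (_ *: _ + _ *: _); ring.
Qed.

Fact loc_scaleDl (M : lmodType R) (x : loc M) :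
  {morph (@loc_scale M)^~ x : a b / a + b}.
Proof.
move: x; elim/fracW=> m t; elim/fracW=> r s; elim/fracW=> r' s'.
rewrite fracD !loc_scaleE fracD; apply: frac_eq.
rewrite /= !regE !scalerDr !scalerA -scalerDl.
by congr (_ *: _); ring.
Qed.

Fact loc_mulC : commutative (@loc_scale R^o).
Proof.
elim/fracW=> r s; elim/fracW=> r' s'; rewrite !loc_scaleE; apply: frac_eq.
by rewrite /= !regE; ring.
Qed.

(* The ring R_p is the localization of the R-module R, with
   (r/s) * (r'/s') = (r r')/(s s'). *)
HB.instance Definition _ := GRing.Zmodule_isComPzRing.Build (loc R^o)
  (@loc_scaleA R^o) loc_mulC (@loc_scale1 R^o)
  (fun a b x => @loc_scaleDl R^o x a b).

HB.instance Definition _ (M : lmodType R) :=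
  GRing.Zmodule_isLmodule.Build (loc R^o) (loc M)
    (@loc_scaleA M) (@loc_scale1 M) (@loc_scaleDr M) (@loc_scaleDl M).

Lemma fracZ (M : lmodType R) (r : R^o) s (m : M) t :
  frac r s *: frac m t = frac (r *: m) (denomM s t).
Proof. exact: loc_scaleE. Qed.

Lemma fracM (r r' : R^o) s s' :
  frac r s * frac r' s' = frac (r * r' : R^o) (denomM s s').
Proof. exact: loc_scaleE. Qed.
End Localization.

Definition free_of_rank (R : pzRingType) (n : nat) (M : lmodType R) :=
  exists f : {linear 'rV[R]_n -> M}, bijective f.

Definition constant_rank (R : comPzRingType) (n : nat) (M : lmodType R) :=
  forall p : prime_ideal R, @free_of_rank (loc p R^o) n (loc p M).

(* Not assumed finitely generated; a projective module of constant rank is. *)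
Definition projective (R : pzRingType) (P : lmodType R) :=
  forall (M N : lmodType R) (g : {linear M -> N}) (f : {linear P -> N}),
    (forall y, exists x, g x = y) ->
    exists h : {linear P -> M}, forall x, g (h x) = f x.

Definition set_coord (T : Type) (n : nat) (x : {ffun 'I_n -> T}) (i : 'I_n)
    (u : T) : {ffun 'I_n -> T} :=
  [ffun j => if j == i then u else x j].

Definition multilinear (R : pzRingType) (M N : lmodType R) (n : nat)
    (f : {ffun 'I_n -> M} -> N) :=
  forall x i c u v, f (set_coord x i (c *: u + v)) =
    c *: f (set_coord x i u) + f (set_coord x i v).

Definition alternating (R : pzRingType) (M N : lmodType R) (n : nat)
    (f : {ffun 'I_n -> M} -> N) :=
  forall (x : {ffun 'I_n -> M}) i j, i != j -> x i = x j -> f x = 0.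

(* The n-th exterior power of M: formal R-linear combinations of n-tuples of
   elements of M, two of them being identified when every alternating
   multilinear map takes the same value on both, that is, when their difference
   lies in the submodule generated by the multilinearity and alternation
   relations. Its universal property is given by wedge_multilinear,
   wedge_alternating, ext_liftE and ext_hom_eq below. *)
Section ExteriorPower.
Variables (R : comPzRingType) (n : nat) (M : lmodType R).

Definition ext_pre := seq (R * {ffun 'I_n -> M}).
HB.instance Definition _ := Choice.on ext_pre.

Definition ext_eval (N : lmodType R) (f : {ffun 'I_n -> M} -> N)
    (s : ext_pre) : N :=
  \sum_(t <- s) t.1 *: f t.2.

Definition ext_eqv : rel ext_pre := fun s t =>
  `[< forall (N : lmodType R) (f : {ffun 'I_n -> M} -> N),
        multilinear f -> alternating f -> ext_eval f s = ext_eval f t >].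

Fact ext_eqv_refl : reflexive ext_eqv.
Proof. by move=> s; apply/asboolP. Qed.

Fact ext_eqv_sym : symmetric ext_eqv.
Proof. by move=> s t; apply/asboolP/asboolP => h N f fm fa; rewrite h. Qed.

Fact ext_eqv_trans : transitive ext_eqv.
Proof.
move=> t s u /asboolP h /asboolP h'; apply/asboolP => N f fm fa.
by rewrite h // h'.
Qed.

Canonical ext_equiv :=
  EquivRel ext_eqv ext_eqv_refl ext_eqv_sym ext_eqv_trans.

Definition extpow : Type := {eq_quot ext_equiv}.
HB.instance Definition _ := EqQuotient.on extpow.
HB.instance Definition _ := Choice.on extpow.

Definition ext_pi (s : ext_pre) : extpow := \pi_extpow s.

Lemma ext_piP (s t : ext_pre) : ext_pi s = ext_pi t <->
  forall (N : lmodType R) (f : {ffun 'I_n -> M} -> N),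
    multilinear f -> alternating f -> ext_eval f s = ext_eval f t.
Proof. by split=> [/eqmodP/asboolP //|h]; apply/eqmodP/asboolP. Qed.

Lemma ext_eval_repr (N : lmodType R) (f : {ffun 'I_n -> M} -> N) s :
  multilinear f -> alternating f ->
  ext_eval f (repr (ext_pi s)) = ext_eval f s.
Proof.
move=> fm fa; have [+ _] := ext_piP (repr (ext_pi s)) s; apply=> //.
by rewrite /ext_pi reprK.
Qed.

Lemma ext_piW (P : extpow -> Prop) : (forall s, P (ext_pi s)) -> forall w, P w.
Proof. by move=> h w; rewrite -[w]reprK; apply: h. Qed.

Definition pre_scale (c : R) (s : ext_pre) : ext_pre :=
  [seq (c * t.1, t.2) | t <- s].

Lemma ext_eval_cat (N : lmodType R) (f : {ffun 'I_n -> M} -> N) s t :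
  ext_eval f (s ++ t) = ext_eval f s + ext_eval f t.
Proof. exact: big_cat. Qed.

Lemma ext_eval_scale (N : lmodType R) (f : {ffun 'I_n -> M} -> N) c s :
  ext_eval f (pre_scale c s) = c *: ext_eval f s.
Proof.
rewrite /ext_eval big_map scaler_sumr.
by apply: eq_bigr => t _; rewrite scalerA.
Qed.

Lemma ext_eval_nil (N : lmodType R) (f : {ffun 'I_n -> M} -> N) :
  ext_eval f [::] = 0.
Proof. exact: big_nil. Qed.

Definition ext_zero : extpow := ext_pi [::].
Definition ext_add (v w : extpow) : extpow := ext_pi (repr v ++ repr w).
Definition ext_scale (c : R) (w : extpow) : extpow :=
  ext_pi (pre_scale c (repr w)).
Definition ext_opp (w : extpow) : extpow := ext_scale (- 1) w.

Lemma ext_addE s t : ext_add (ext_pi s) (ext_pi t) = ext_pi (s ++ t).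
Proof. by apply/ext_piP => N f fm fa; rewrite !ext_eval_cat !ext_eval_repr. Qed.

Lemma ext_scaleE c s : ext_scale c (ext_pi s) = ext_pi (pre_scale c s).
Proof.
by apply/ext_piP => N f fm fa; rewrite !ext_eval_scale !ext_eval_repr.
Qed.

Let extE := (ext_addE, ext_scaleE).
Let evalE := (ext_eval_cat, ext_eval_scale, ext_eval_nil).

Fact ext_addA : associative ext_add.
Proof. by elim/ext_piW=> s; elim/ext_piW=> t; elim/ext_piW=> u; rewrite !extE catA. Qed.

Fact ext_addC : commutative ext_add.
Proof.
elim/ext_piW=> s; elim/ext_piW=> t; rewrite !extE.
by apply/ext_piP => N f _ _; rewrite !evalE addrC.
Qed.

Fact ext_add0 : left_id ext_zero ext_add.
Proof. by elim/ext_piW=> s; rewrite !extE. Qed.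

Fact ext_addN : left_inverse ext_zero ext_opp ext_add.
Proof.
elim/ext_piW=> s; rewrite /ext_opp !extE.
by apply/ext_piP => N f _ _; rewrite !evalE scaleN1r addNr.
Qed.

HB.instance Definition _ :=
  GRing.isZmodule.Build extpow ext_addA ext_addC ext_add0 ext_addN.

Lemma ext_piD s t : ext_pi s + ext_pi t = ext_pi (s ++ t).
Proof. exact: ext_addE. Qed.

Fact ext_scaleA c d w : ext_scale c (ext_scale d w) = ext_scale (c * d) w.
Proof.
elim/ext_piW: w => s; rewrite !extE.
by apply/ext_piP => N f _ _; rewrite !evalE scalerA.
Qed.

Fact ext_scale1 : left_id 1 ext_scale.
Proof.
by elim/ext_piW=> s; rewrite extE; apply/ext_piP => N f _ _; rewrite !evalE scale1r.
Qed.

Fact ext_scaleDr : right_distributive ext_scale +%R.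
Proof.
move=> c; elim/ext_piW=> s; elim/ext_piW=> t; rewrite !(extE, ext_piD).
by apply/ext_piP => N f _ _; rewrite !evalE scalerDr.
Qed.

Fact ext_scaleDl w : {morph ext_scale^~ w : c d / c + d}.
Proof.
move=> c d; elim/ext_piW: w => s; rewrite !(extE, ext_piD).
by apply/ext_piP => N f _ _; rewrite !evalE scalerDl.
Qed.

HB.instance Definition _ := GRing.Zmodule_isLmodule.Build R extpow
  ext_scaleA ext_scale1 ext_scaleDr ext_scaleDl.

Lemma ext_piZ c s : c *: ext_pi s = ext_pi (pre_scale c s).
Proof. exact: ext_scaleE. Qed.

Definition wedge (x : {ffun 'I_n -> M}) : extpow := ext_pi [:: (1, x)].

Let eval1 (N : lmodType R) (f : {ffun 'I_n -> M} -> N) x :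
  ext_eval f [:: (1, x)] = f x.
Proof. by rewrite /ext_eval big_seq1 scale1r. Qed.

Lemma wedge_multilinear : multilinear wedge.
Proof.
move=> x i c u v; rewrite ext_piZ ext_piD; apply/ext_piP => N f fm _.
by rewrite !evalE !eval1 fm.
Qed.

Lemma wedge_alternating : alternating wedge.
Proof.
move=> x i j ij xij; apply/ext_piP => N f _ fa.
by rewrite evalE eval1 (fa x i j).
Qed.

Lemma ext_piE s : ext_pi s = \sum_(t <- s) t.1 *: wedge t.2.
Proof.
elim: s => [|t s IHs]; first by rewrite big_nil.
rewrite big_cons -IHs ext_piZ ext_piD; apply/ext_piP => N f _ _.
by rewrite !evalE eval1 /ext_eval big_cons.
Qed.

Section Lift.
Variables (N : lmodType R) (f : {ffun 'I_n -> M} -> N).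
Hypotheses (fm : multilinear f) (fa : alternating f).

Definition ext_lift_fun (w : extpow) : N := ext_eval f (repr w).

Fact ext_lift_linear : linear ext_lift_fun.
Proof.
move=> c; elim/ext_piW=> s; elim/ext_piW=> t.
by rewrite ext_piZ ext_piD /ext_lift_fun !ext_eval_repr // !evalE.
Qed.

Definition ext_lift : {linear extpow -> N} :=
  HB.pack ext_lift_fun
    (GRing.isLinear.Build R extpow N _ ext_lift_fun ext_lift_linear).

Lemma ext_liftE x : ext_lift (wedge x) = f x.
Proof. by rewrite /= /ext_lift_fun ext_eval_repr // eval1. Qed.
End Lift.

Lemma ext_hom_eq (N : lmodType R) (g h : {linear extpow -> N}) :
  (forall x, g (wedge x) = h (wedge x)) -> g =1 h.
Proof.
move=> gh; elim/ext_piW=> s; rewrite ext_piE !linear_sum.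
by apply: eq_bigr => t _; rewrite !linearZ /= gh.
Qed.
End ExteriorPower.

Section ExteriorMap.
Variables (R : comPzRingType) (n : nat) (M N : lmodType R).
Variable f : {linear M -> N}.

Let fwedge (x : {ffun 'I_n -> M}) : extpow n N := wedge [ffun i => f (x i)].

Let map_coord (x : {ffun 'I_n -> M}) i u :
  [ffun j => f (set_coord x i u j)] = set_coord [ffun j => f (x j)] i (f u).
Proof. by apply/ffunP => j; rewrite !ffunE; case: eqP. Qed.

Fact ext_map_multilinear : multilinear fwedge.
Proof.
by move=> x i c u v; rewrite /fwedge !map_coord linearP wedge_multilinear.
Qed.

Fact ext_map_alternating : alternating fwedge.
Proof.
move=> x i j ij xij; apply: (wedge_alternating (i := i) (j := j)) => //.
by rewrite !ffunE xij.
Qed.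

Definition ext_map : {linear extpow n M -> extpow n N} :=
  ext_lift ext_map_multilinear ext_map_alternating.

Lemma ext_map_wedge x : ext_map (wedge x) = wedge [ffun i => f (x i)].
Proof. exact: ext_liftE. Qed.
End ExteriorMap.

(* The endomorphism phi of a projective module M of constant rank n acts on the
   invertible module extpow n M as multiplication by its determinant d. *)
Definition has_det (R : comPzRingType) (n : nat) (M : lmodType R)
    (phi : {linear M -> M}) (d : R) :=
  forall w : extpow n M, ext_map n phi w = d *: w.

(* thetaV stands for theta^-1, for a trivialization theta : R -> det P; chi is
   q |-> (x |-> theta^-1 (x /\ q)). *)
Section Chi.
Variables (R : comPzRingType) (P : lmodType R).

Definition wedge2 (x y : P) : extpow 2 P :=
  wedge [ffun i => tnth [tuple x; y] i].

Fact wedge2_linearl y : linear (wedge2^~ y).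
Proof.
move=> c u v; pose x : {ffun 'I_2 -> P} := [ffun i => tnth [tuple 0; y] i].
have E w : wedge2 w y = wedge (set_coord x ord0 w).
  by congr wedge; apply/ffunP => j; rewrite !ffunE; case: j => [[|[|]] ?].
by rewrite !E wedge_multilinear.
Qed.

Variable thetaV : {linear extpow 2 P -> R^o}.

Definition chi_fun (q x : P) : R^o := thetaV (wedge2 x q).

Fact chi_linear q : linear (chi_fun q).
Proof. by move=> c u v; rewrite /chi_fun wedge2_linearl linearP. Qed.

HB.instance Definition _ q :=
  GRing.isLinear.Build R P R^o _ (chi_fun q) (chi_linear q).

Definition chi (q : P) : {linear P -> R^o} := chi_fun q.

(* The preimage of f under chi; 0 if f is not in the range of chi. *)
Definition chi_inv (f : {linear P -> R^o}) : P :=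
  xget 0 [set u | forall x, chi u x = f x]%classic.
End Chi.

Section BlockMap.
Variables (R : pzRingType) (M1 M2 N1 N2 : lmodType R).
Variables (f11 : {linear M1 -> N1}) (f12 : {linear M2 -> N1}).
Variables (f21 : {linear M1 -> N2}) (f22 : {linear M2 -> N2}).

Definition block_fun (x : M1 * M2) : N1 * N2 :=
  (f11 x.1 + f12 x.2, f21 x.1 + f22 x.2).

Fact block_linear : linear block_fun.
Proof.
move=> c [u1 u2] [v1 v2]; rewrite /block_fun /= !linearP.
by congr pair; rewrite /= scalerDr addrACA.
Qed.

HB.instance Definition _ :=
  GRing.isLinear.Build R (M1 * M2)%type (N1 * N2)%type _ block_fun block_linear.

Definition block_map : {linear (M1 * M2)%type -> (N1 * N2)%type} := block_fun.
End BlockMap.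

Section Restrictions.
Variables (R : comPzRingType) (P : lmodType R).
Variable a : {linear (P * R^o)%type -> R^o}.

Definition restr0_fun (x : P) : R^o := a (x, 0).
Fact restr0_linear : linear restr0_fun.
Proof.
move=> c u v; rewrite /restr0_fun -linearP; congr (a _).
by congr pair; rewrite /= scaler0 addr0.
Qed.
HB.instance Definition _ :=
  GRing.isLinear.Build R P R^o _ restr0_fun restr0_linear.
Definition restr0 : {linear P -> R^o} := restr0_fun.

Definition restrR_fun (r : R^o) : R^o := a (0, r).
Fact restrR_linear : linear restrR_fun.
Proof.
move=> c u v; rewrite /restrR_fun -linearP; congr (a _).
by congr pair; rewrite /= scaler0 addr0.
Qed.
HB.instance Definition _ :=
  GRing.isLinear.Build R R^o R^o _ restrR_fun restrR_linear.
Definition restrR : {linear R^o -> R^o} := restrR_fun.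

(* The square here is that of the scalar a_R(1), not a composite. *)
Definition restrR_sq : {linear R^o -> R^o} := (restrR 1 ^+ 2) \*: idfun.
End Restrictions.

(* 1 |-> u *)
Section Pick.
Variables (R : comPzRingType) (M : lmodType R).
Definition pick_fun (u : M) (r : R^o) : M := (r : R) *: u.
Fact pick_linear u : linear (pick_fun u).
Proof. by move=> c x y; rewrite /pick_fun scalerDl scalerA. Qed.
HB.instance Definition _ u :=
  GRing.isLinear.Build R R^o M _ (pick_fun u) (pick_linear u).
Definition pick1 (u : M) : {linear R^o -> M} := pick_fun u.
End Pick.

Section Phi.
Variables (R : comPzRingType) (P : lmodType R).
Variable thetaV : {linear extpow 2 P -> R^o}.
Variable a : {linear (P * R^o)%type -> R^o}.
Variable s : {linear R^o -> (P * R^o)%type}.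

Definition phi0 (q : P) (p : R) : {linear P -> P} :=
  (\- ((fst \o s) \o chi thetaV q)) \- (p \*: idfun).

Definition phiR (q : P) : {linear R^o -> P} :=
  pick1 ((2 * restrR a 1) *: q + chi_inv thetaV (restr0 a)).

Definition phi_map (q : P) (p : R) :
    {linear (P * R^o)%type -> (P * R^o)%type} :=
  block_map (phi0 q p) (phiR q) (restr0 a) (restrR_sq a).
End Phi.

(* Main.v *)
(* Let <x,y> = theta^-1 (x /\ y). At each prime, P0 is spanned up to
   denominators by two elements, so every alternating trilinear map on P0
   vanishes. Applied to <x,y> z + <y,z> x + <z,x> y this gives the Plücker
   relation, and writing 1 = sum <x_i,y_i> it yields
   z = sum (<z,y_i> x_i - <z,x_i> y_i), whence chi_0 is bijective. Applied to
   alternating trilinear maps on P0 + R it shows that these are multiples of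
     volume(v_1, v_2, v_3) = r_3 <x_1,x_2> + r_1 <x_2,x_3> + r_2 <x_3,x_1>
   (v_i = (x_i, r_i)), so that the determinant of phi is 1 as soon as phi
   preserves volume on the triples ((x,0), (y,0), (0,1)), where the Plücker
   relation gives <x,y> (a_0(q) + a_R(1) p)^2 = <x,y>. The inverse of phi is its
   adjugate. *)
From mathcomp Require Import all_boot all_algebra ring.
From mathcomp Require Import boolp classical_sets.
(* Last, so that [frac] is not the one of [fraction]. *)
Require Import Defs.
Set Implicit Arguments.
Unset Strict Implicit.
Unset Printing Implicit Defensive.
Import GRing.Theory.
Local Open Scope ring_scope.

(** * Existence of prime ideals above a proper ideal *)

Section ProperIdeals.
Variable R : comPzRingType.

Definition proper_ideal (J : set R) :=
  [/\ J 0, forall x y, J x -> J y -> J (x + y),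
      forall a x, J x -> J (a * x) & ~ J 1].

(** Suppose [x * y] is in [J] and [x] is not. By maximality [K = J + R x] cannot be proper, so
    [1 = m + r * x] with [m] in [J]; multiplying by [y] puts [y] in [J]. *)
Lemma maximal_ideal_prime (J : set R) : proper_ideal J ->
  (forall K, proper_ideal K -> (J `<=` K)%classic -> (K `<=` J)%classic) ->
  exists p : prime_ideal R, forall x, (x \in p) <-> J x.
Proof.
move=> [J0 JD JM J1] Jmax.
pose p : {pred R} := fun x => `[< J x >].
have pP x : reflect (J x) (x \in p) by exact: asboolP.
have p0 : 0 \in p by apply/pP.
have p1 : 1 \notin p by apply/pP.
have pD : {in p &, forall x y, x + y \in p}.
  by move=> x y /pP Jx /pP Jy; apply/pP/JD.
have pM a : {in p, forall x, a * x \in p}.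
  by move=> x /pP Jx; apply/pP/JM.
have pprime x y : x * y \in p -> (x \in p) || (y \in p).
  move=> /pP Jxy; apply/orP.
  have [Jx|nJx] := pselect (J x); first by left; apply/pP.
  right; apply/pP.
  pose K : set R := [set z | exists2 m, J m & exists r, z = m + r * x]%classic.
  have KM a z : K z -> K (a * z).
    move=> [m Jm [r ->]]; exists (a * m); first exact: JM.
    by exists (a * r); ring.
  have [[m Jm [r e]]|nK1] := pselect (K 1).
    have -> : y = y * m + r * (x * y) by rewrite -[LHS]mulr1 e; ring.
    by apply: JD; apply: JM.
  case: nJx; apply: (Jmax K); last by exists 0 => //; exists 1; ring.
    split=> //; first by exists 0 => //; exists 0; ring.
    move=> _ _ [m Jm [r ->]] [m' Jm' [r' ->]].
    by exists (m + m'); [exact: JD|exists (r + r'); ring].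
  by move=> z Jz; exists z => //; exists 0; ring.
by exists (PrimeIdeal p0 pD pM p1 pprime) => x; split=> /pP.
Qed.

Lemma proper_ideal_sub_prime (J : set R) : proper_ideal J ->
  exists p : prime_ideal R, forall x, J x -> x \in p.
Proof.
move=> JI; have [J0 JD JM J1] := JI.
(* Taking the union with [J] makes the empty chain harmless: its union is the empty set, which
   satisfies [P] because [J] is proper. *)
pose P (A : set R) := proper_ideal (J `|` A)%classic.
have [F FP Ftot|A [PA Amax]] := @Zorn_bigcup R P.
  have sub X : F X ->
      ((J `|` X) `<=` (J `|` \bigcup_(Y in F) Y))%classic.
    by move=> FX x [Jx|Xx]; [left|right; exists X].
  have cover x : (J `|` \bigcup_(Y in F) Y)%classic x ->
      J x \/ exists2 X, F X & (J `|` X)%classic x.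
    by move=> [Jx|[X FX Xx]]; [left|right; exists X => //; right].
  split; first by left.
  - move=> x y /cover[Jx|[X FX Xx]] /cover[Jy|[Y FY Yy]].
    + by left; apply: JD.
    + by apply: (sub Y) => //; have [_ YD _ _] := FP _ FY; apply: YD => //; left.
    + by apply: (sub X) => //; have [_ XD _ _] := FP _ FX; apply: XD => //; left.
    + have [XY|YX] := Ftot _ _ FX FY.
        apply: (sub Y) => //; have [_ YD _ _] := FP _ FY; apply: YD => //.
        by case: Xx => [|/XY]; [left|right].
      apply: (sub X) => //; have [_ XD _ _] := FP _ FX; apply: XD => //.
      by case: Yy => [|/YX]; [left|right].
  - move=> a x /cover[Jx|[X FX Xx]]; first by left; apply: JM.
    by apply: (sub X) => //; have [_ _ XM _] := FP _ FX; apply: XM.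
  - by move=> /cover[//|[X FX X1]]; have [] := FP _ FX.
have [K KI AK|p pE] := maximal_ideal_prime PA; last first.
  by exists p => x Jx; apply/pE; left.
(* A point of [K] outside the union of [J] and [A] would make [A] strictly smaller than [K], against
   the maximality of [A]. *)
move=> x Kx; have [//|nx] := pselect ((J `|` A)%classic x).
have JK : (J `|` K)%classic = K.
  by apply/seteqP; split=> [y [Jy|//]|y]; [apply: AK; left|right].
case: (Amax K); last by rewrite /P JK.
split; first by move=> y Ay; apply: AK; right.
by move=> KA; apply: nx; right; apply: KA.
Qed.

End ProperIdeals.

(** * Vanishing and generation at a prime *)

Definition vanishes_at (R : comPzRingType) (M : lmodType R)
  (p : prime_ideal R) (m : M) := exists2 u : R, u \notin p & u *: m = 0.

Section LocalVanishing.
Variables (R : comPzRingType) (M : lmodType R).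

(** The condition [vanishes_at p m] means that [m] becomes zero in the localization at [p]. If [m]
    is nonzero, its annihilator is a proper ideal, hence lies in some prime [p], and no element
    outside [p] can annihilate [m]. *)
Lemma local_vanishing (m : M) :
  (forall p : prime_ideal R, vanishes_at p m) -> m = 0.
Proof.
move=> m0; apply: contrapT => mn0.
pose J : set R := [set r | r *: m = 0]%classic.
have [|p Jp] := @proper_ideal_sub_prime R J.
  split; rewrite /J /=.
  - by rewrite scale0r.
  - by move=> x y x0 y0; rewrite scalerDl x0 y0 addr0.
  - by move=> a x x0; rewrite -scalerA x0 scaler0.
  - by rewrite scale1r.
by have [u /negP up /Jp] := m0 p.
Qed.

Variable p : prime_ideal R.

Lemma vanishes_at0 : vanishes_at p (0 : M).
Proof. by exists 1; rewrite ?prime1 ?scaler0. Qed.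

Lemma vanishes_atZ c (m : M) : vanishes_at p m -> vanishes_at p (c *: m).
Proof. by move=> [u up u0]; exists u; rewrite // scalerA mulrC -scalerA u0 scaler0. Qed.

Lemma vanishes_atD (m m' : M) :
  vanishes_at p m -> vanishes_at p m' -> vanishes_at p (m + m').
Proof.
move=> [u up u0] [v vp v0]; exists (u * v).
  by apply/negP => /primeM; rewrite (negPf up) (negPf vp).
by rewrite scalerDr -[(u * v) *: m']scalerA v0 mulrC -scalerA u0 !scaler0 addr0.
Qed.

Lemma vanishes_at_scaled u (m : M) :
  u \notin p -> vanishes_at p (u *: m) -> vanishes_at p m.
Proof.
move=> up [v vp]; rewrite scalerA => vu0; exists (v * u) => //.
by apply/negP => /primeM; rewrite (negPf up) (negPf vp).
Qed.

(** The generators are the numerators of a basis of the localization. Expanding [x / 1] in that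
    basis and clearing denominators gives the relation over [R]. *)
Lemma local_generators n : constant_rank n M ->
  exists e : 'I_n -> M, forall x : M, exists2 u, u \notin p &
    exists c : 'I_n -> R, u *: x = \sum_i c i *: e i.
Proof.
move=> /(_ p)[f [g _ gK]].
pose e i := repr (f (delta_mx 0 i)).
exists (fun i => (e i).1) => x.
(* A combination of the basis over the localized ring is brought to a common denominator [t], one
   summand at a time. *)
have sumE (v : 'I_n -> loc p R^o) (r : seq 'I_n) : exists c : 'I_n -> R,
    exists t : denom p, \sum_(i <- r) v i *: f (delta_mx 0 i) =
      frac (\sum_i c i *: (e i).1) t.
  elim: r => [|j r [c [t IH]]].
    exists (fun=> 0), (denom1 p); rewrite big_nil.
    by rewrite big1 // => i _; rewrite scale0r.
  rewrite big_cons IH [v j]fracE [f _]fracE -/(e j) fracZ fracD.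
  set d := denomM _ (e j).2.
  exists (fun i => (if i == j then sval t * (repr (v j)).1 else 0) + sval d * c i).
  exists (denomM d t); congr (frac _ _).
  under [RHS]eq_bigr do rewrite scalerDl.
  rewrite big_split /=; congr (_ + _).
    rewrite (bigD1 j) //= eqxx big1 ?addr0 ?scalerA // => i /negPf ->.
    by rewrite scale0r.
  by rewrite scaler_sumr; apply: eq_bigr => i _; rewrite scalerA.
have [c [t ct]] := sumE (g (frac x (denom1 p)) 0) (index_enum 'I_n).
have : frac x (denom1 p) = frac (\sum_i c i *: (e i).1) t.
  rewrite -ct -[LHS]gK {1}[g _]row_sum_delta linear_sum.
  by apply: eq_bigr => i _; rewrite linearZ.
move=> /fracP[u]; rewrite /= scale1r scalerA => uE.
exists (sval u * sval t); first exact: (valP (denomM u t)).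
exists (fun i => sval u * c i); rewrite uE scaler_sumr.
by apply: eq_bigr => i _; rewrite scalerA.
Qed.

End LocalVanishing.

(** * Multilinear maps, and alternating maps in more variables than the rank *)

Section MultilinearMaps.
Variables (R : comPzRingType) (M N : lmodType R) (n : nat).
Variable f : {ffun 'I_n -> M} -> N.
Hypothesis fm : multilinear f.

Lemma set_coord_id (x : {ffun 'I_n -> M}) i : set_coord x i (x i) = x.
Proof. by apply/ffunP => j; rewrite ffunE; case: eqP => [->|]. Qed.

Lemma multilinearD x i u v :
  f (set_coord x i (u + v)) = f (set_coord x i u) + f (set_coord x i v).
Proof. by rewrite -[u]scale1r fm !scale1r. Qed.

Lemma multilinear0 x i : f (set_coord x i 0) = 0.
Proof. by apply: (addIr (f (set_coord x i 0))); rewrite -multilinearD addr0 add0r. Qed.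

Lemma multilinearZ x i c u :
  f (set_coord x i (c *: u)) = c *: f (set_coord x i u).
Proof. by rewrite -[c *: u]addr0 fm multilinear0 addr0. Qed.

Lemma multilinear_sum x i (I : Type) (r : seq I) (u : I -> M) :
  f (set_coord x i (\sum_(j <- r) u j)) = \sum_(j <- r) f (set_coord x i (u j)).
Proof. by elim/big_rec2: _ => [|j y z _ <-]; [exact: multilinear0|exact: multilinearD]. Qed.

End MultilinearMaps.

(** Vanishing is tested at each prime. Up to a factor outside [p], every coordinate is a combination
    of [n] local generators, so multilinearity reduces to tuples of generators; among [n + 1] of
    these two coincide. *)
Lemma alternating_above_rank (R : comPzRingType) (n : nat) (M N : lmodType R)
    (f : {ffun 'I_n.+1 -> M} -> N) :
  constant_rank n M -> multilinear f -> alternating f -> forall x, f x = 0.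
Proof.
move=> rkM fm fa x; apply: local_vanishing => p.
have [e eP] := local_generators p rkM.
(* [k] bounds the coordinates that are not yet local generators. *)
have main k (y : {ffun 'I_n.+1 -> M}) :
    (forall i : 'I_n.+1, (k <= i)%N -> exists j, y i = e j) -> vanishes_at p (f y).
  elim: k y => [|k IH] y ye.
    pose h (i : 'I_n.+1) := sval (cid (ye i isT)).
    have hE i : y i = e (h i) by rewrite /h; case: cid.
    have /injectivePn[i [j ij hij]] : ~~ injectiveb h.
      by apply/injectiveP => /leq_card; rewrite !card_ord ltnn.
    by rewrite (fa y i j) ?hE ?hij //; exact: vanishes_at0.
  have [kn|nk] := ltnP k n.+1; last first.
    by apply: IH => i ki; move: (leq_trans nk ki); rewrite leqNgt ltn_ord.
  pose i0 := Ordinal kn; have [u up [c uE]] := eP (y i0).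
  apply: (vanishes_at_scaled up).
  rewrite -{1}(set_coord_id y i0) -multilinearZ // uE multilinear_sum //.
  elim/big_ind: _ => [|a b|j _]; [exact: vanishes_at0|exact: vanishes_atD|].
  rewrite multilinearZ //; apply/vanishes_atZ/IH => i ki; rewrite ffunE.
  case: eqP => [_|/eqP ii0]; first by exists j.
  by apply: ye; rewrite ltn_neqAle ki andbT eq_sym.
by apply: (main n.+1) => i; rewrite leqNgt ltn_ord.
Qed.

(** * The alternating pairing on [P] *)

Section VolumeForm.
Variables (R : comPzRingType) (P : lmodType R).
Variable thetaV : {linear extpow 2 P -> R^o}.

(** With this order of arguments, [chi thetaV q x] is [area x q]. *)
Definition area (x y : P) : R := thetaV (wedge2 x y).

Lemma wedge2_self (x : P) : wedge2 x x = 0.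
Proof.
by apply: (@wedge_alternating _ _ _ _ ord0 ord_max) => //; rewrite !ffunE.
Qed.

Lemma wedge2_linearr (x : P) : linear (wedge2 x).
Proof.
move=> c u v; pose y : {ffun 'I_2 -> P} := [ffun i => tnth [tuple x; 0] i].
have E w : wedge2 x w = wedge (set_coord y ord_max w).
  by congr wedge; apply/ffunP => j; rewrite !ffunE; case: j => [[|[|]] ?].
by rewrite !E wedge_multilinear.
Qed.

Lemma areaPl c x y z : area (c *: x + y) z = c * area x z + area y z.
Proof. by rewrite /area wedge2_linearl linearP. Qed.

Lemma areaPr c x y z : area z (c *: x + y) = c * area z x + area z y.
Proof. by rewrite /area wedge2_linearr linearP. Qed.

Lemma areaDl x y z : area (x + y) z = area x z + area y z.
Proof. by rewrite -[x]scale1r areaPl mul1r scale1r. Qed.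

Lemma areaDr x y z : area z (x + y) = area z x + area z y.
Proof. by rewrite -[x]scale1r areaPr mul1r scale1r. Qed.

Lemma area0l z : area 0 z = 0.
Proof. by apply: (addIr (area 0 z)); rewrite -areaDl addr0 add0r. Qed.

Lemma area0r z : area z 0 = 0.
Proof. by apply: (addIr (area z 0)); rewrite -areaDr addr0 add0r. Qed.

Lemma areaZl c x z : area (c *: x) z = c * area x z.
Proof. by rewrite -[c *: x]addr0 areaPl area0l addr0. Qed.

Lemma areaZr c x z : area z (c *: x) = c * area z x.
Proof. by rewrite -[c *: x]addr0 areaPr area0r addr0. Qed.

Lemma areaNl x z : area (- x) z = - area x z.
Proof. by rewrite -scaleN1r areaZl mulN1r. Qed.

Lemma areaNr x z : area z (- x) = - area z x.
Proof. by rewrite -scaleN1r areaZr mulN1r. Qed.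

Lemma area_self x : area x x = 0.
Proof. by rewrite /area wedge2_self linear0. Qed.

Lemma areaC x y : area y x = - area x y.
Proof.
apply/eqP; rewrite -addr_eq0; apply/eqP.
by have := area_self (y + x); rewrite areaDl !areaDr !area_self add0r addr0.
Qed.

Definition area_linE :=
  (areaDl, areaDr, areaZl, areaZr, areaNl, areaNr, area_self, area0l, area0r).

End VolumeForm.

(** * Alternating maps of three variables *)

Section Triples.
Variables (R : comPzRingType) (M : lmodType R).

Definition triple (x y z : M) : {ffun 'I_3 -> M} :=
  [ffun i => tnth [tuple x; y; z] i].

Let i0 : 'I_3 := ord0.
Let i1 : 'I_3 := Ordinal (isT : (1 < 3)%N).
Let i2 : 'I_3 := ord_max.

Lemma ord3W (Q : 'I_3 -> Prop) : Q i0 -> Q i1 -> Q i2 -> forall i, Q i.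
Proof.
move=> Q0 Q1 Q2 [[|[|[|//]]] lti].
- by rewrite (_ : Ordinal lti = i0) //; apply: val_inj.
- by rewrite (_ : Ordinal lti = i1) //; apply: val_inj.
- by rewrite (_ : Ordinal lti = i2) //; apply: val_inj.
Qed.

Lemma tripleE (x : {ffun 'I_3 -> M}) : x = triple (x i0) (x i1) (x i2).
Proof. by apply/ffunP; apply: ord3W; rewrite ffunE. Qed.

Lemma set_triple0 x y z u : set_coord (triple x y z) i0 u = triple u y z.
Proof. by apply/ffunP; apply: ord3W; rewrite !ffunE. Qed.

Lemma set_triple1 x y z u : set_coord (triple x y z) i1 u = triple x u z.
Proof. by apply/ffunP; apply: ord3W; rewrite !ffunE. Qed.

Lemma set_triple2 x y z u : set_coord (triple x y z) i2 u = triple x y u.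
Proof. by apply/ffunP; apply: ord3W; rewrite !ffunE. Qed.

Lemma multilinear_triple (N : lmodType R) (f : {ffun 'I_3 -> M} -> N) :
  (forall y z, linear (fun x => f (triple x y z))) ->
  (forall x z, linear (fun y => f (triple x y z))) ->
  (forall x y, linear (fun z => f (triple x y z))) -> multilinear f.
Proof.
move=> f0 f1 f2 x i c u v; rewrite (tripleE x); move: i.
by apply: ord3W; rewrite !(set_triple0, set_triple1, set_triple2);
  [exact: f0|exact: f1|exact: f2].
Qed.

Lemma alternating_triple (N : lmodType R) (f : {ffun 'I_3 -> M} -> N) :
  (forall x z, f (triple x x z) = 0) -> (forall x y, f (triple x y x) = 0) ->
  (forall x y, f (triple x y y) = 0) -> alternating f.
Proof.
move=> f01 f02 f12 x i j; rewrite (tripleE x); move: i j.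
by apply: ord3W; apply: ord3W; rewrite ?eqxx // !ffunE //= => _;
  rewrite ?(tnth_nth 0) /= => ->.
Qed.

Section Form.
Variables (N : lmodType R) (F : {ffun 'I_3 -> M} -> N).
Hypotheses (Fm : multilinear F) (Fa : alternating F).

Lemma tripleD0 x x' y z :
  F (triple (x + x') y z) = F (triple x y z) + F (triple x' y z).
Proof. by have := multilinearD Fm (triple 0 y z) i0 x x'; rewrite !set_triple0. Qed.

Lemma tripleD1 x y y' z :
  F (triple x (y + y') z) = F (triple x y z) + F (triple x y' z).
Proof. by have := multilinearD Fm (triple x 0 z) i1 y y'; rewrite !set_triple1. Qed.

Lemma tripleD2 x y z z' :
  F (triple x y (z + z')) = F (triple x y z) + F (triple x y z').
Proof. by have := multilinearD Fm (triple x y 0) i2 z z'; rewrite !set_triple2. Qed.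

Lemma tripleZ0 c x y z : F (triple (c *: x) y z) = c *: F (triple x y z).
Proof. by have := multilinearZ Fm (triple 0 y z) i0 c x; rewrite !set_triple0. Qed.

Lemma tripleZ1 c x y z : F (triple x (c *: y) z) = c *: F (triple x y z).
Proof. by have := multilinearZ Fm (triple x 0 z) i1 c y; rewrite !set_triple1. Qed.

Lemma tripleZ2 c x y z : F (triple x y (c *: z)) = c *: F (triple x y z).
Proof. by have := multilinearZ Fm (triple x y 0) i2 c z; rewrite !set_triple2. Qed.

Lemma triple01 x z : F (triple x x z) = 0.
Proof. by apply: (Fa (i := i0) (j := i1)) => //; rewrite !ffunE. Qed.

Lemma triple02 x y : F (triple x y x) = 0.
Proof. by apply: (Fa (i := i0) (j := i2)) => //; rewrite !ffunE. Qed.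

Lemma triple12 x y : F (triple x y y) = 0.
Proof. by apply: (Fa (i := i1) (j := i2)) => //; rewrite !ffunE. Qed.

Lemma triple_swap01 x y z : F (triple y x z) = - F (triple x y z).
Proof.
apply/eqP; rewrite -addr_eq0; apply/eqP; have := triple01 (y + x) z.
by rewrite tripleD0 !tripleD1 !triple01 add0r addr0.
Qed.

Lemma triple_swap12 x y z : F (triple x z y) = - F (triple x y z).
Proof.
apply/eqP; rewrite -addr_eq0; apply/eqP; have := triple12 x (z + y).
by rewrite tripleD1 !tripleD2 !triple12 add0r addr0.
Qed.

Lemma triple_rot x y z : F (triple y z x) = F (triple x y z).
Proof. by rewrite triple_swap12 triple_swap01 opprK. Qed.

End Form.
End Triples.

(** * The Plücker relation and the bijectivity of [chi] *)

Section Oriented.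
Variables (R : comPzRingType) (P : lmodType R).
Hypothesis rkP : constant_rank 2 P.
Variable theta : {linear R^o -> extpow 2 P}.
Variable thetaV : {linear extpow 2 P -> R^o}.
Hypotheses (thetaK : cancel theta thetaV) (thetaVK : cancel thetaV theta).

Local Notation "<< x , y >>" := (area thetaV x y).

Let plucker_fun (v : {ffun 'I_3 -> P}) : P :=
  let: (x, y, z) := (v ord0, v (Ordinal (isT : (1 < 3)%N)), v ord_max) in
  <<x, y>> *: z + <<y, z>> *: x + <<z, x>> *: y.

Let plucker_triple x y z : plucker_fun (triple x y z) =
  <<x, y>> *: z + <<y, z>> *: x + <<z, x>> *: y.
Proof. by rewrite /plucker_fun !ffunE !(tnth_nth 0). Qed.

Lemma plucker x y z : <<x, y>> *: z + <<y, z>> *: x + <<z, x>> *: y = 0.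
Proof.
rewrite -plucker_triple; apply: alternating_above_rank => //.
  apply: multilinear_triple => u v c w w' /=; rewrite !plucker_triple;
  rewrite !(areaPl, areaPr) !(scalerDl, scalerDr) !scalerA
    ?[<<_, _>> * c]mulrC -!scalerA;
  by rewrite [X in X + _ = _]addrACA [LHS]addrACA.
apply: alternating_triple => u v; rewrite plucker_triple area_self scale0r.
- by rewrite add0r (areaC _ u v) scaleNr addrN.
- by rewrite addr0 (areaC _ u v) scaleNr addrN.
- by rewrite addr0 (areaC _ u v) scaleNr addrN.
Qed.

Lemma area_decomposition : exists r : seq (P * P),
  forall z, z = \sum_(t <- r) (<<z, t.2>> *: t.1 - <<z, t.1>> *: t.2).
Proof.
have [r r1] : exists r : seq (P * P), \sum_(t <- r) <<t.1, t.2>> = 1.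
  (* A representative of [theta 1] is a formal combination of pairs; each coefficient is absorbed
     into the first vector of its pair. *)
  pose h (t : R * {ffun 'I_2 -> P}) := (t.1 *: t.2 ord0, t.2 ord_max).
  exists (map h (repr (theta 1))).
  transitivity (thetaV (ext_pi (repr (theta 1)))); last by rewrite /ext_pi reprK.
  rewrite ext_piE linear_sum big_map; apply: eq_bigr => -[c x] _ /=.
  rewrite areaZl linearZ /=; congr (_ * thetaV (wedge _)).
  apply/ffunP => -[[|[|//]] lti]; rewrite ffunE (tnth_nth 0) /=;
    by congr (x _); apply: val_inj.
exists r => z; rewrite -[LHS]scale1r -r1 scaler_suml; apply: eq_bigr => t _.
have /eqP := plucker t.1 t.2 z; rewrite -addrA addr_eq0 => /eqP ->.
by rewrite opprD (areaC _ z) scaleNr opprK.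
Qed.

(** The decomposition recovers a vector from its pairings. Hence [chi] is injective, and identities
    in [P] can be checked in [R]. *)
Lemma area_nondegenerate x y : (forall z, <<z, x>> = <<z, y>>) -> x = y.
Proof.
have [r rE] := area_decomposition => xy; rewrite (rE x) (rE y).
by apply: eq_bigr => t _; rewrite !(areaC _ _ x) !(areaC _ _ y) !xy.
Qed.

Lemma area_representable (f : {linear P -> R^o}) :
  exists u, forall x, <<x, u>> = f x.
Proof.
have [r rE] := area_decomposition.
(* The witness is read off by applying [f] to the decomposition of [x] and moving the coefficients
   [f t.1] and [f t.2] into the second argument of the pairing. *)
exists (\sum_(t <- r) ((f t.1 : R) *: t.2 - (f t.2 : R) *: t.1)) => x.
rewrite {2}(rE x) linear_sum.
elim/big_rec2: _ => [|t y u _ <-]; first exact: area0r.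
rewrite areaDr; congr (_ + _).
by rewrite linearB areaDr areaNr !areaZr; congr (_ - _); rewrite linearZ /=; exact: mulrC.
Qed.

(** By representability [f] is in the range of [chi], so [chi_inv] picks a genuine preimage. *)
Lemma chi_invP (f : {linear P -> R^o}) x : <<x, chi_inv thetaV f>> = f x.
Proof.
have [u uf] := area_representable f.
have : exists u, forall x, chi thetaV u x = f x by exists u.
by move=> /(@xgetPex _ 0); apply.
Qed.

(** [G] factors through a linear map [L] on the exterior square, where the wedge of [x] and [y] is
    [<<x, y>>] times [theta 1]; so [g] is [L (theta 1)]. *)
Lemma alternating_area (N : lmodType R) (G : P -> P -> N) :
  (forall z, linear (G^~ z)) -> (forall z, linear (G z)) ->
  (forall x, G x x = 0) -> exists g, forall x y, G x y = <<x, y>> *: g.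
Proof.
move=> Gl Gr G0.
pose f (v : {ffun 'I_2 -> P}) := G (v ord0) (v ord_max).
have fm : multilinear f.
  move=> v i c x y; rewrite /f !ffunE.
  case: i => [[|[|//]] lti]; rewrite !(eq_sym ord0) !(eq_sym ord_max) /eq_op /=.
    exact: Gl.
  exact: Gr.
have fa : alternating f.
  move=> v i j ij vij; rewrite /f; suff -> : v ord0 = v ord_max by [].
  have o k : (k == ord0 :> 'I_2) || (k == ord_max).
    by case: k => [[|[|//]] ?].
  move: ij vij; case/orP: (o i) => /eqP ->; case/orP: (o j) => /eqP -> //.
pose L := ext_lift fm fa.
exists (L (theta 1)) => x y.
have -> : G x y = L (wedge2 x y) by rewrite ext_liftE /f !ffunE !(tnth_nth 0).
rewrite -[wedge2 x y]thetaVK -linearZ -linearZ /=.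
by congr (L (theta _)); exact/esym/mulr1.
Qed.

End Oriented.

(** * Alternating trilinear maps on the sum of [P] and [R] *)

Section FormsOnSum.
Variables (R : comPzRingType) (P : lmodType R).
Hypothesis rkP : constant_rank 2 P.

Local Notation PR := (P * R^o)%type.
Local Notation base x := ((x, 0 : R^o) : PR).
Local Notation pole := ((0 : P, 1 : R^o) : PR).

Lemma pair_decomposition (v : PR) :
  v = base v.1 + (v.2 : R) *: pole.
Proof.
case: v => x r; congr pair => /=; first by rewrite scaler0 addr0.
by rewrite add0r; apply/esym/mulr1.
Qed.

Section Form.
Variables (N : lmodType R) (F : {ffun 'I_3 -> PR} -> N).
Hypotheses (Fm : multilinear F) (Fa : alternating F).

Lemma alternating3_base x y z : F (triple (base x) (base y) (base z)) = 0.
Proof.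
pose f (v : {ffun 'I_3 -> P}) := F [ffun i => (v i, 0)].
have fE (v : {ffun 'I_3 -> P}) i w :
    [ffun j => (set_coord v i w j, 0 : R^o)] =
    set_coord [ffun j => (v j, 0)] i (w, 0).
  by apply/ffunP => j; rewrite !ffunE; case: eqP.
have -> : triple (base x) (base y) (base z) = [ffun i => (triple x y z i, 0)].
  by apply/ffunP; apply: ord3W; rewrite !ffunE !(tnth_nth 0).
apply: (@alternating_above_rank _ _ _ _ f) => //.
  move=> v i c w w'; rewrite /f !fE -Fm; congr (F (set_coord _ _ _)).
  by congr pair; rewrite /= scaler0 addr0.
by move=> v i j ij vij; apply: (Fa (i := i) (j := j)); rewrite ?ffunE ?vij.
Qed.

(** When every argument is split along [P] and [pole], terms with a repeated pole vanish by
    alternation and the term without a pole by the rank of [P]. Cyclic rotation moves the single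
    remaining pole to the last place. *)
Lemma alternating3_expand (v1 v2 v3 : PR) : F (triple v1 v2 v3) =
  (v3.2 : R) *: F (triple (base v1.1) (base v2.1) pole) +
  (v1.2 : R) *: F (triple (base v2.1) (base v3.1) pole) +
  (v2.2 : R) *: F (triple (base v3.1) (base v1.1) pole).
Proof.
rewrite {1}[v1]pair_decomposition {1}[v2]pair_decomposition.
rewrite {1}[v3]pair_decomposition.
rewrite !(tripleD0, tripleD1, tripleD2, tripleZ0, tripleZ1, tripleZ2) //.
rewrite alternating3_base !(triple01, triple02, triple12) // !(scaler0, addr0, add0r).
rewrite (triple_rot Fm Fa (base v3.1) (base v1.1)).
by rewrite -(triple_rot Fm Fa pole (base v2.1)) addrAC.
Qed.

End Form.

Lemma alternating3_eq (N : lmodType R) (F F' : {ffun 'I_3 -> PR} -> N) :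
  multilinear F -> alternating F -> multilinear F' -> alternating F' ->
  (forall x y, F (triple (base x) (base y) pole) =
               F' (triple (base x) (base y) pole)) ->
  F =1 F'.
Proof.
move=> Fm Fa Fm' Fa' FF' v.
by rewrite (tripleE v) (alternating3_expand Fm Fa) (alternating3_expand Fm' Fa') !FF'.
Qed.

Variable theta : {linear R^o -> extpow 2 P}.
Variable thetaV : {linear extpow 2 P -> R^o}.
Hypotheses (thetaK : cancel theta thetaV) (thetaVK : cancel thetaV theta).

Local Notation "<< x , y >>" := (area thetaV x y).

(** This is the Laplace expansion of a 3 by 3 determinant along the row of [R]-coordinates, with
    [area] for the 2 by 2 minors. *)
Definition volume (v1 v2 v3 : PR) : R :=
  v3.2 * <<v1.1, v2.1>> + v1.2 * <<v2.1, v3.1>> + v2.2 * <<v3.1, v1.1>>.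

(** With [pole] as last argument, [F] is an alternating bilinear map on [P], hence a multiple of
    [area]; the expansion then has [g] as a common factor. *)
Lemma alternating3_volume (N : lmodType R) (F : {ffun 'I_3 -> PR} -> N) :
  multilinear F -> alternating F ->
  exists g, forall v1 v2 v3, F (triple v1 v2 v3) = volume v1 v2 v3 *: g.
Proof.
move=> Fm Fa.
pose G x y := F (triple (base x) (base y) pole).
have pairP c (x y : P) : (c *: x + y, 0 : R^o) = c *: base x + (base y).
  by congr pair; rewrite /= scaler0 addr0.
have [|||g gE] := alternating_area thetaVK (G := G).
- by move=> z c x y; rewrite /G pairP tripleD0 // tripleZ0.
- by move=> z c x y; rewrite /G pairP tripleD1 // tripleZ1.
- by move=> x; rewrite /G triple01.
exists g => v1 v2 v3; rewrite (alternating3_expand Fm Fa) -!/(G _ _) !gE.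
by rewrite !scalerA -!scalerDl.
Qed.

End FormsOnSum.

(** * The endomorphism [phi]: explicit formula, inverse and determinant *)

Section Completion.
Variables (R : comPzRingType) (P : lmodType R).
Hypothesis rkP : constant_rank 2 P.
Variable theta : {linear R^o -> extpow 2 P}.
Variable thetaV : {linear extpow 2 P -> R^o}.
Hypotheses (thetaK : cancel theta thetaV) (thetaVK : cancel thetaV theta).
Variables (a : {linear (P * R^o)%type -> R^o}).
Variables (s : {linear R^o -> (P * R^o)%type}) (q : P) (p : R).
Hypotheses (sK : cancel s a) (s1 : s 1 = (q, p)).

Local Notation "<< x , y >>" := (area thetaV x y).
Local Notation phi := (phi_map thetaV a s q p).
Let f x : R := restr0 a x.
Let b : R := restrR a 1.
Let u : P := chi_inv thetaV (restr0 a).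

Lemma area_chi_inv x : <<x, u>> = f x.
Proof. exact: (chi_invP rkP thetaK). Qed.

(** The section property at 1, written in coordinates. *)
Lemma section_eq : f q + b * p = 1.
Proof.
transitivity (a (s 1)); last exact: sK.
rewrite s1 (pair_decomposition (q, p)) linearD linearZ /=.
by congr (_ + _); apply: mulrC.
Qed.

Lemma phiE x (r : R^o) : phi (x, r) =
  (- (<<x, q>> *: q) - p *: x + (r : R) *: ((2 * b) *: q + u),
   f x + b ^+ 2 * (r : R) : R^o).
Proof.
congr pair => /=; congr (- _ - _ + _).
(* The scalar [<<x, q>>] is a multiple of 1, so linearity reduces [s] to its value [(q, p)]
   there. *)
transitivity (fst (s (<<x, q>> *: (1 : R^o)))).
  by congr (fst (s _)); apply/esym/mulr1.
by rewrite linearZ s1.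
Qed.

(** The Plücker relation for [x], [y], [q], paired with [u]: pairing with [u] on the right is
    [f]. *)
Lemma area_restr0 x y : <<x, y>> * f q = <<x, q>> * f y - <<y, q>> * f x.
Proof.
have := congr1 (area thetaV ^~ u) (plucker rkP thetaV x y q).
rewrite /= !area_linE !area_chi_inv [<<q, x>>]areaC => e.
by apply/eqP; rewrite -subr_eq0 -e; apply/eqP; ring.
Qed.

Let f0 : f 0 = 0. Proof. exact: linear0. Qed.

Let area_ql z : <<q, z>> = - <<z, q>>. Proof. exact: areaC. Qed.

Let area_ul z : <<u, z>> = - f z. Proof. by rewrite areaC area_chi_inv. Qed.

Let fD x y : f (x + y) = f x + f y. Proof. exact: linearD. Qed.

Let fN x : f (- x) = - f x. Proof. exact: linearN. Qed.

Let fZ c x : f (c *: x) = c * f x. Proof. exact: linearZ. Qed.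

Let fu : f u = 0. Proof. by rewrite -area_chi_inv area_self. Qed.

Lemma volume_phi x y :
  volume thetaV (phi (x, 0)) (phi (y, 0)) (phi (0, 1)) = <<x, y>>.
Proof.
transitivity ((f q + b * p) ^+ 2 * <<x, y>>); last by rewrite section_eq; ring.
(* This is what the expanded volume gives directly; [area_restr0] turns the last factor into
   [<<x, y>> * f q], which completes the square. *)
transitivity ((b * p) ^+ 2 * <<x, y>> +
    (f q + 2 * (b * p)) * (<<x, q>> * f y - <<y, q>> * f x)); last first.
  by rewrite -area_restr0; ring.
rewrite !phiE /volume /= !area_linE !area_ul !area_chi_inv !area_ql f0.
ring.
Qed.

(* The adjugate of phi, in block form. *)
Let psi (v : P * R^o) : P * R^o :=
  ((b ^+ 2 * <<v.1, q>>) *: q - (b ^+ 2 * p + 2 * b * f q) *: v.1 +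
   f v.1 *: ((2 * b) *: q + u) + (v.2 : R) *: ((1 + b * p) *: q + p *: u),
   p ^+ 2 * (v.2 : R) + p * f v.1 - <<v.1, q>> * f q : R^o).

(** This relation and the next are solved for a monomial, so that [ring] can use them as rewriting
    rules. *)
Let bpE : b * p = 1 - f q.
Proof. by rewrite -section_eq; ring. Qed.

Let relE x z : <<z, q>> * f x = <<z, x>> * f q + <<x, q>> * f z.
Proof. by rewrite area_restr0; ring. Qed.

(** Both composites with [psi] are computed. Pairing the component in [P] with an arbitrary [z]
    leaves polynomial identities modulo [section_eq] and [area_restr0]. *)
Lemma phi_bij : bijective phi.
Proof.
exists psi => -[x r]; rewrite phiE /psi /=.
  congr pair.
    apply: (area_nondegenerate rkP thetaK) => z.
    rewrite !(area_linE, fD, fN, fZ, fu, area_ul, area_chi_inv).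
    ring: bpE (relE x z).
  rewrite !(area_linE, fD, fN, fZ, fu, area_ul).
  ring: bpE.
congr pair.
  apply: (area_nondegenerate rkP thetaK) => z.
  rewrite !(area_linE, fD, fN, fZ, fu, area_ul, area_chi_inv).
  ring: bpE (relE x z).
rewrite !(area_linE, fD, fN, fZ, fu, area_ul).
ring: bpE.
Qed.

Lemma phi_det : has_det 3 phi 1.
Proof.
(* Seen as two linear maps on the exterior cube, [ext_map] and the identity need only be compared on
   wedges, and then, both being alternating, on triples ending in the pole. *)
move=> w; rewrite scale1r -[RHS]/(idfun w).
apply: ext_hom_eq => v; rewrite ext_map_wedge.
move: v; apply: (alternating3_eq rkP) => [||||x y].
- exact: ext_map_multilinear.
- exact: ext_map_alternating.
- exact: wedge_multilinear.
- exact: wedge_alternating.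
have [g gE] := alternating3_volume rkP thetaVK (@wedge_multilinear R 3 (P * R^o)%type)
  (@wedge_alternating R 3 (P * R^o)%type).
have -> (v1 v2 v3 : P * R^o) :
    [ffun i => phi (triple v1 v2 v3 i)] = triple (phi v1) (phi v2) (phi v3).
  by apply/ffunP; apply: ord3W; rewrite !ffunE !(tnth_nth 0).
(* Both wedges are multiples of the same [g], with coefficient [<<x, y>>] in each case. *)
rewrite !gE volume_phi /volume /= !area_linE; congr (_ *: g); ring.
Qed.

End Completion.

Theorem proposition4p18
  (R : comPzRingType) (P0 : lmodType R)
  (projP0 : projective P0) (rankP0 : constant_rank 2 P0)
  (theta0 : {linear R^o -> extpow 2 P0})
  (theta0V : {linear extpow 2 P0 -> R^o})
  (theta0K : cancel theta0 theta0V) (theta0VK : cancel theta0V theta0)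
  (a : {linear (P0 * R^o)%type -> R^o})
  (a_surj : forall r : R^o, exists x, a x = r)
  (s : {linear R^o -> (P0 * R^o)%type}) (sK : cancel s a)
  (q : P0) (p : R) (s1 : s 1 = (q, p)) :
  let phi := phi_map theta0V a s q p in
  [/\ bijective phi,
      has_det 3 phi 1
    & forall (x : P0) (r : R^o),
        (phi (x, r)).2 = restr0 a x + restrR_sq a r].
Proof.
(* The formula for the second component holds by computation from the block form. *)
split=> //.
- exact: (phi_bij rankP0 theta0K sK s1).
- exact: (phi_det rankP0 theta0K theta0VK sK s1).
Qed.
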